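(* Let $\mathcal{H}=(X,\varphi,G,r)$ be a (non-blocking) hybrid dynamical system satisfying the Trapping Guard Condition, and let $S\subset X$ be an isolated invariant set under $\mathcal{H}$. If $\Sigma\mathrm{CH}_*(S)\neq0$, then $S\neq\emptyset$.
   Context: Notation: $\mathbb{R}^+=[0,\infty)$, $\mathbb{Z}^+=\{0,1,2,\dots\}$, $X$ is a compact metric space, $\mathbb{F}$ a fixed (finite) field of coefficients. Local semiflow. A local semiflow on $X$ is a continuous map $\varphi:\mathcal{U}\to X$, where $\mathcal{U}\subseteq\mathbb{R}^+\times X$ is an open neighborhood of $\{0\}\times X$, with $\varphi(0,x)=x$, and such that $(t,x)\in\mathcal{U}$ and $(s,\varphi(t,x))\in\mathcal{U}$ imply $(s+t,x)\in\mathcal{U}$ and $\varphi(s+t,x)=\varphi(s,\varphi(t,x))$. It is a semiflow if $\mathcal{U}=\mathbb{R}^+\times X$. Hybrid system. A hybrid dynamical system (HDS) is $\mathcal{H}=(X,\varphi,G,r)$ with $\varphi$ a local semiflow on $X$, $G\subseteq X$ closed (guard), $r:G\to X$ continuous (reset). Impact time: $\sigma(x)=\inf\{t\ge 0: (t,x)\in\mathcal{U},\ \varphi(t,x)\in G\}\in[0,\infty]$ ($\inf\emptyset=\infty$). Hybrid trajectory of $x$: continuous maps $(\gamma_n:I_n\to X)_{n=0}^J$, $J\in\mathbb{Z}^+\cup\{\infty\}$, with $t_0=0$, $\gamma_0(0)=x$, $t_{n+1}=t_n+\sigma(\gamma_n(t_n))$, $I_n=[t_n,t_{n+1}]$ (for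 $n<J$), $I_J=[t_J,t_{J+1})$ if $J<\infty$, $\gamma_{n+1}(t_{n+1})=r(\gamma_n(t_{n+1}))$, and $\gamma_n(t)=\varphi(t-t_n,\gamma_n(t_n))$ for $t\in[t_n,t_{n+1})$ if $t_n<t_{n+1}$. Write $\psi_x(t,n)=\gamma_n(t)$ on $\mathrm{dom}(\psi_x)=\bigcup_n I_n\times\{n\}$, and $\psi([0,\infty),x)=\psi_x(\mathrm{dom}(\psi_x))$. Non-blocking (assumed): every hybrid trajectory is either defined for all $t\ge0$ (with finitely or infinitely many jumps) or is Zeno ($J=\infty$, $t_n\to T<\infty$). Backward hybrid trajectory through $x$: continuous maps $(\gamma_n:I_n\to X)_{n=0}^{-J}$, $J\in\mathbb{Z}^+\cup\{\infty\}$, with $t_0=0\ge t_{-1}\ge t_{-2}\ge\cdots$, $\gamma_0(0)=x$, $I_n=[t_{n-1},t_n]$ for $-J<n\le0$ and, if $J<\infty$, $I_{-J}=(-\infty,t_{-J}]$; $\gamma_n(t)\notin G$ for $t$ in the interior of $I_n$; $\gamma_n(t_n)\in G$ and $r(\gamma_n(t_n))=\gamma_{n+1}(t_n)$ for $n<0$; $\gamma_n(t')=\varphi(t'-t,\gamma_n(t))$ for $t\le t'$ in $I_n$. Trapping Guard Condition (TGC): there is an open neighborhood $U\subseteq X$ of $G$ such that $\sigma|_U$ is (finite and) continuous and $H(x,s)=\varphi(s\,\sigma(x),x)$ defines a strong deformation retraction $H:U\times[0,1]\to U$ of $U$ onto $G$ (continuous, $H(x,0)=x$, $H(x,1)\in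 G$, $H(g,s)=g$ for $g\in G$). Suspension. $X'=(X\sqcup(G\times[0,1]))/(x\sim(x,0),\,x\in G)$, $\iota:X\hookrightarrow X'$ the inclusion, $\sigma'(\iota(x))=\sigma(x)+1$, $\sigma'(x,s)=1-s$ on $G\times(0,1]$. For $0\le t\le\sigma'(z)$ ($t<\infty$): $\varphi'(t,\iota(x))=\iota(\varphi(t,x))$ if $x\notin G$, $t<\sigma(x)$; $\varphi'(t,\iota(x))=(\varphi(\sigma(x),x),t-\sigma(x))$ if $x\notin G$, $t\ge\sigma(x)$; $\varphi'(t,(x,s))=(x,s+t)$ on $G\times[0,1]$. $\Sigma_{\mathcal{H}}X$ is the quotient of $X'$ by $(g,1)\sim\iota(r(g))$, $g\in G$, with quotient map $\pi$. The hybrid suspension semiflow $\Phi_{\mathcal{H}}$ on $\Sigma_{\mathcal{H}}X$ is induced by $\Phi_{\mathcal{H}}(t,[z])=[\varphi'(t,z)]$ for $t\le\sigma'(z)$, continued through the identification by the semigroup property. Known: under TGC, $\Sigma_{\mathcal{H}}X$ is compact metrizable and $\Phi_{\mathcal{H}}$ is a (continuous) semiflow. $\pi_0:X'\to X$ collapses the cylinder ($\iota(x)\mapsto x$, $(g,s)\mapsto g$); for $A\subseteq X$, $\Sigma_{\mathcal{H}}(A)=\pi(\pi_0^{-1}(A))$. Invariance. For a semiflow $\Phi$ on $Y$: $\mathrm{Inv}^+(B)=\{y:\Phi([0,\infty),y)\subseteq B\}$; $\mathrm{Inv}^-(B)$ is the set of $y$ with a map $\gamma:(-\infty,0]\to B$,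 $\gamma(0)=y$, $\Phi(s,\gamma(t))=\gamma(t+s)$ for $s\ge0$, $t+s\le0$. For $\mathcal{H}$: $\mathrm{Inv}^+(B,\mathcal{H})=\{x:\psi([0,\infty),x)\subseteq B\}$; $\mathrm{Inv}^-(B,\mathcal{H})$ is the set of $x$ having a backward hybrid trajectory with image in $B$. In both settings $B$ is invariant if $B=\mathrm{Inv}^+(B)=\mathrm{Inv}^-(B)$, $\mathrm{Inv}(K)=\mathrm{Inv}^+(K)\cap\mathrm{Inv}^-(K)$, a compact $K$ is an isolating neighborhood if $\mathrm{Inv}(K)\subseteq\mathrm{int}(K)$, and then $\mathrm{Inv}(K)$ is called an isolated invariant set. Conley index. For an isolated invariant set $S$ of a semiflow $\Phi$, an index pair is a pair of compact sets $L\subset N$ with: (i) $S=\mathrm{Inv}(\mathrm{cl}(N\setminus L))$ and $S\subseteq\mathrm{int}(N\setminus L)$; (ii) $x\in L$ and $\Phi([0,T],x)\subseteq N$ imply $\Phi([0,T],x)\subseteq L$; (iii) if $x\in N$ and $\Phi([0,\infty),x)\not\subseteq N$, there is $T>0$ with $\Phi([0,T],x)\subseteq N$ and $\Phi(T,x)\in L$. The (homological) Conley index is $CH_k(S)=H_k(N,L;\mathbb{F})$ for an index pair $(N,L)$ (independent, up to isomorphism, of the index pair by classical theory). If $S$ is an isolated invariant set of an HDS $\mathcal{H}$ satisfying TGC, then $\Sigma_{\mathcal{H}}(S)$ is an isolated invariant set of $\Phi_{\mathcal{H}}$ and the suspension Conley index is $\Sigma\mathrm{CH}_*(S)=CH_*(\Sigma_{\mathcal{H}}(S))$.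 *)

(* Defs.v *)
From HB Require Import structures.
From Stdlib Require Import Relation_Operators.
From mathcomp Require Import all_boot all_order all_algebra.
From mathcomp Require Import generic_quotient freeg.
From mathcomp Require Import all_classical all_reals all_analysis.

Set Implicit Arguments.
Unset Strict Implicit.
Unset Printing Implicit Defensive.

Import Order.TTheory GRing.Theory Num.Theory.
Import numFieldNormedType.Exports.

Local Open Scope classical_set_scope.
Local Open Scope ring_scope.
Local Open Scope quotient_scope.

(* The quotient of [T] by the equivalence relation generated by [e]. *)
Section Gluing.
Variables (T : topologicalType) (e : T -> T -> Prop).

Definition glue_rel (x y : T) : bool := `[< clos_refl_sym_trans T e x y >].

Lemma glue_rel_refl : reflexive glue_rel.
Proof. by move=> x; apply/asboolP; exact: rst_refl. Qed.

Lemma glue_rel_sym : symmetric glue_rel.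
Proof. by move=> x y; apply/asboolP/asboolP; exact: rst_sym. Qed.

Lemma glue_rel_trans : transitive glue_rel.
Proof. by move=> y x z /asboolP xy /asboolP yz; apply/asboolP/(rst_trans _ _ _ y). Qed.

Definition glue_equiv := EquivRel glue_rel glue_rel_refl glue_rel_sym glue_rel_trans.

Definition glue : topologicalType := quotient_topology {eq_quot glue_equiv}.

Definition glue_pi (x : T) : glue := \pi_{eq_quot glue_equiv} x.

Definition glue_repr (q : glue) : T := repr (q : {eq_quot glue_equiv}).

End Gluing.

(* [U] is open relatively to [0, oo) x X. *)
Definition local_semiflow (R : realType) (X : topologicalType)
    (U : set (R * X)) (phi : R -> X -> X) : Prop :=
  [/\ exists2 O : set (R * X), open O & U = O `&` [set p | 0 <= p.1],
      forall x, U (0, x),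
      {within U, continuous (fun p => phi p.1 p.2)},
      forall x, phi 0 x = x &
      forall s t x, U (t, x) -> U (s, phi t x) ->
        U (s + t, x) /\ phi (s + t) x = phi s (phi t x)].

(* The values of [flow] outside [flow_dom] are irrelevant. *)
Record hybrid_system (R : realType) (X : metricType R) := HybridSystem {
  flow_dom : set (R * X);
  flow : R -> X -> X;
  guard : set X;
  reset : guard -> X;
  flow_local_semiflow : local_semiflow flow_dom flow;
  guard_closed : closed guard;
  reset_continuous : continuous reset
}.

(* Comparison with [J] in {0, 1, 2, ...} U {oo}, where [None] stands for oo. *)
Definition le_ext (n : nat) (J : option nat) : bool :=
  if J is Some j then (n <= j)%N else true.
Definition lt_ext (n : nat) (J : option nat) : bool :=
  if J is Some j then (n < j)%N else true.

(* A set coerces to the type of its elements, with the subspace topology. *)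
Definition unit_interval (R : realType) : set R := [set s | 0 <= s <= 1].
Arguments unit_interval : clear implicits.

Section Hybrid.
Variables (R : realType) (X : metricType R) (H : hybrid_system X).

Definition impact_time (x : X) : \bar R :=
  ereal_inf [set t%:E | t in
    [set t | [/\ 0 <= t, flow_dom H (t, x) & guard H (flow H t x)]]].

Let sigma := impact_time.

Section Trajectory.
Variables (J : option nat) (t : nat -> R) (gam : nat -> R -> X).

Definition traj_interval (n : nat) : set R :=
  [set s | t n <= s /\
    if lt_ext n J then s <= t n.+1
    else (s%:E < (t n)%:E + sigma (gam n (t n)))%E].

Definition hybrid_trajectory (x : X) : Prop :=
  [/\ t 0 = 0 /\ gam 0 0 = x,
      forall n, lt_ext n J -> ((t n.+1)%:E = (t n)%:E + sigma (gam n (t n)))%E,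
      forall n, le_ext n J -> {within traj_interval n, continuous (gam n)},
      forall n, lt_ext n J -> exists g : guard H,
        set_val g = gam n (t n.+1) /\ gam n.+1 (t n.+1) = reset g &
      forall n s, le_ext n J -> t n <= s ->
        (s%:E < (t n)%:E + sigma (gam n (t n)))%E ->
        flow_dom H (s - t n, gam n (t n)) /\
        gam n s = flow H (s - t n) (gam n (t n))].

Definition traj_image : set X :=
  [set y | exists n s, [/\ le_ext n J, traj_interval n s & y = gam n s]].

Definition traj_total : Prop :=
  forall s, 0 <= s -> exists2 n, le_ext n J & traj_interval n s.

Definition traj_zeno : Prop :=
  J = None /\ exists T : R, t n @[n --> \oo] --> T.

Definition back_interval (n : nat) : set R :=
  [set s | s <= t n /\ (lt_ext n J -> t n.+1 <= s)].

(* [t n] and [gam n] stand for t_{-n} and gamma_{-n}. *)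
Definition backward_trajectory (x : X) : Prop :=
  [/\ t 0 = 0 /\ gam 0 0 = x,
      forall n, lt_ext n J -> t n.+1 <= t n,
      forall n, le_ext n J -> {within back_interval n, continuous (gam n)} /\
        forall s, (back_interval n)° s -> ~ guard H (gam n s),
      forall n, lt_ext n J -> exists g : guard H,
        set_val g = gam n.+1 (t n.+1) /\ reset g = gam n (t n.+1) &
      forall n s s', le_ext n J -> back_interval n s -> back_interval n s' ->
        s <= s' -> flow_dom H (s' - s, gam n s) /\
        gam n s' = flow H (s' - s) (gam n s)].

Definition back_image : set X :=
  [set y | exists n s, [/\ le_ext n J, back_interval n s & y = gam n s]].

End Trajectory.

(* Truncating a trajectory at a jump formally gives another trajectory, so psi_x
   is the one that is total or Zeno; it is unique, and it exists for all x when
   the system is non-blocking. *)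
Definition full_trajectory (x : X) J (t : nat -> R) (gam : nat -> R -> X) :=
  hybrid_trajectory J t gam x /\ (traj_total J t gam \/ traj_zeno J t).

Definition nonblocking : Prop :=
  forall x, exists J t gam, full_trajectory x J t gam.

Definition trapping_guard_condition : Prop :=
  exists U : set X,
    [/\ open U /\ guard H `<=` U,
        forall x, U x -> (sigma x < +oo)%E,
        {within U, continuous (fun x => fine (sigma x))},
        forall x s, U x -> 0 <= s <= 1 ->
          flow_dom H (s * fine (sigma x), x) /\
          U (flow H (s * fine (sigma x)) x) &
        let D := fun p : X * R => flow H (p.2 * fine (sigma p.1)) p.1 in
        [/\ {within U `*` `[0, 1], continuous D},
            forall x, U x -> D (x, 0) = x,
            forall x, U x -> guard H (D (x, 1)) &
            forall g s, guard H g -> 0 <= s <= 1 -> D (g, s) = g]].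

Definition hybrid_inv_pos (B : set X) : set X :=
  [set x | exists J t gam, full_trajectory x J t gam /\
                           traj_image J t gam `<=` B].

Definition hybrid_inv_neg (B : set X) : set X :=
  [set x | exists J t gam, backward_trajectory J t gam x /\
                           back_image J t gam `<=` B].

Definition hybrid_inv (K : set X) : set X := hybrid_inv_pos K `&` hybrid_inv_neg K.

Definition hybrid_isolated_invariant (S : set X) : Prop :=
  exists K : set X, [/\ compact K, hybrid_inv K `<=` K° & S = hybrid_inv K].

Definition cylinder : Type := (guard H * unit_interval R)%type.

HB.instance Definition _ := Topological.on cylinder.

Definition presusp_part (b : bool) : topologicalType :=
  if b then (X : topologicalType) else (cylinder : topologicalType).

Definition presusp : topologicalType := {b : bool & presusp_part b}.

Definition pre_base (x : X) : presusp := existT presusp_part true x.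
Definition pre_cyl (g : guard H) (s : unit_interval R) : presusp :=
  existT presusp_part false (g, s).

Definition bottom_rel (a b : presusp) : Prop :=
  exists g s, [/\ set_val s = 0 :> R, a = pre_base (set_val g) & b = pre_cyl g s].

(* X', which glues x in G to (x, 0) *)
Definition trapping_space : topologicalType := glue bottom_rel.

Definition tbase (x : X) : trapping_space := glue_pi bottom_rel (pre_base x).
Definition tcyl (g : guard H) (s : unit_interval R) : trapping_space :=
  glue_pi bottom_rel (pre_cyl g s).

Definition pre_collapse (a : presusp) : X :=
  match a with
  | existT true x => x
  | existT false p => set_val p.1
  end.
(* pi_0 : X' -> X; [pre_collapse] is constant on the classes of [bottom_rel]. *)
Definition collapse (z : trapping_space) : X := pre_collapse (glue_repr z).

Definition top_rel (a b : trapping_space) : Prop :=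
  exists g s, [/\ set_val s = 1 :> R, a = tcyl g s & b = tbase (reset g)].

Definition suspension : topologicalType := glue top_rel.

Definition susp_pi (z : trapping_space) : suspension := glue_pi top_rel z.

Definition susp_set (A : set X) : set suspension :=
  susp_pi @` (collapse @^-1` A).

(* [trapping_flow t z z'] : 0 <= t <= sigma'(z) and phi'(t, z) = z'. The bound
   t <= sigma'(z) is carried by the height of the endpoint being in [0, 1]. *)
Inductive trapping_flow (t : R) : trapping_space -> trapping_space -> Prop :=
| TFlowBase x : ~ guard H x -> 0 <= t -> (t%:E < sigma x)%E ->
    trapping_flow t (tbase x) (tbase (flow H t x))
| TFlowImpact x u g s : ~ guard H x -> sigma x = u%:E ->
    set_val g = flow H u x -> set_val s = t - u ->
    trapping_flow t (tbase x) (tcyl g s)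
| TFlowCyl g s s' : 0 <= t -> set_val s' = set_val s + t ->
    trapping_flow t (tcyl g s) (tcyl g s').

End Hybrid.

Arguments susp_set {R X} H A _.

Section Semiflow.
Variables (R : realType) (Y : topologicalType) (Phi : R -> Y -> Y).

Definition semiflow : Prop :=
  [/\ {within [set p : R * Y | 0 <= p.1], continuous (fun p => Phi p.1 p.2)},
      forall y, Phi 0 y = y &
      forall s t y, 0 <= s -> 0 <= t -> Phi (s + t) y = Phi s (Phi t y)].

Definition inv_pos (B : set Y) : set Y :=
  [set y | forall t, 0 <= t -> B (Phi t y)].

Definition inv_neg (B : set Y) : set Y :=
  [set y | exists gam : R -> Y,
    [/\ forall t, t <= 0 -> B (gam t), gam 0 = y &
        forall s t, 0 <= s -> t + s <= 0 -> Phi s (gam t) = gam (t + s)]].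

Definition invariant_part (K : set Y) : set Y := inv_pos K `&` inv_neg K.

Definition stays_until (T : R) (y : Y) (B : set Y) : Prop :=
  forall t, 0 <= t <= T -> B (Phi t y).

Definition index_pair (S N L : set Y) : Prop :=
  [/\ [/\ compact N, compact L & L `<=` N],
      S = invariant_part (closure (N `\` L)) /\ S `<=` (N `\` L)°,
      forall y T, L y -> 0 <= T -> stays_until T y N -> stays_until T y L &
      forall y, N y -> ~ inv_pos N y ->
        exists T, [/\ 0 < T, stays_until T y N & L (Phi T y)]].

End Semiflow.

(* For a non-blocking system, [trapping_flow] is the graph of phi', and sigma' >= 1
   after each passage through the identification (g, 1) ~ r(g); so this formula
   and the semigroup law determine [Phi t] for all t >= 0. *)
Definition suspension_semiflow (R : realType) (X : metricType R)
    (H : hybrid_system X) (Phi : R -> suspension H -> suspension H) : Prop :=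
  semiflow Phi /\
  forall t z z', trapping_flow t z z' -> Phi t (susp_pi z) = susp_pi z'.

Section Singular.
Variables (R : realType) (Y : topologicalType).

Definition std_simplex (n : nat) : set 'rV[R]_n.+1 :=
  [set v | (forall i, 0 <= v ord0 i) /\ \sum_i v ord0 i = 1].
Arguments std_simplex : clear implicits.

Definition face_point n (i : 'I_n.+2) (v : 'rV[R]_n.+1) : 'rV[R]_n.+2 :=
  \row_j oapp (v ord0) 0 (unlift i j).

Lemma face_point_simplex n (i : 'I_n.+2) (v : std_simplex n) :
  face_point i (set_val v) \in std_simplex n.+1.
Proof.
have [v_ge0 v_sum] : std_simplex n (set_val v) by exact: set_valP.
rewrite inE; split=> [j|].
  by rewrite mxE; case: unlift => //= k; exact: v_ge0.
rewrite (bigD1_ord i)//= mxE unlift_none/= add0r -v_sum.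
by apply: eq_bigr => k _; rewrite mxE liftK.
Qed.

Definition face_map n (i : 'I_n.+2) (v : std_simplex n) : std_simplex n.+1 :=
  exist _ (face_point i (set_val v)) (face_point_simplex i v).

Lemma face_map_continuous n (i : 'I_n.+2) : continuous (@face_map n i).
Proof.
apply: continuous_comp_initial => v A [P vP PA].
have PAw : forall w : std_simplex n,
    (forall j, P ord0 j (face_point i (set_val w) ord0 j)) ->
    A (face_point i (set_val w)).
  by move=> w Pw; apply: PA => a j; rewrite ord1; exact: Pw.
apply: (filterS PAw).
apply: (@filter_forall _ _ (fun j (w : std_simplex n) =>
  P ord0 j (face_point i (set_val w) ord0 j)) _ (nbhs_filter v)) => j; have := vP ord0 j.
rewrite /= mxE; case E: (unlift i j) => [k|] /= Pj; last first.
  by near=> w; rewrite mxE E; exact: nbhs_singleton Pj.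
have := @continuous_comp _ _ _ (set_val : std_simplex n -> _)
  (fun w : 'rV[R]_n.+1 => w ord0 k) v (@initial_continuous _ _ _ v)
  (@coord_continuous _ _ _ ord0 k _).
move=> /(_ _ Pj) Pv; apply: (@filterS _ _ (nbhs_filter v) _ _ _ Pv) => w.
by rewrite /= mxE E.
Unshelve. all: by end_near. Qed.

Record singular_simplex (n : nat) := SingularSimplex {
  simplex_map : std_simplex n -> Y;
  simplex_continuous : continuous simplex_map
}.
Arguments simplex_continuous {n} s.

HB.instance Definition _ n := gen_eqMixin (singular_simplex n).
HB.instance Definition _ n := gen_choiceMixin (singular_simplex n).

Lemma simplex_face_continuous n (c : singular_simplex n.+1) (i : 'I_n.+2) :
  continuous (simplex_map c \o face_map i).
Proof.
move=> v; apply: continuous_comp; first exact: face_map_continuous.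
exact: simplex_continuous.
Qed.

Definition simplex_face n (c : singular_simplex n.+1) (i : 'I_n.+2) :
  singular_simplex n := SingularSimplex (@simplex_face_continuous n c i).

Variable F : fieldType.

Definition chain (n : nat) := {freeg (singular_simplex n) / F}.

Definition boundary n : chain n.+1 -> chain n :=
  fglift (fun c => \sum_(i < n.+2) (-1) ^+ i *: << simplex_face c i >>).

Definition chain_in n (A : set Y) : set (chain n) :=
  [set c | forall s, s \in dom c -> forall v, A (simplex_map s v)].

(* Relative cycles and boundaries are taken in C_n(N), before the quotient by
   C_n(L): H_n(N, L; F) is [relative_cycle n N L] modulo [relative_boundary n N L]. *)
Definition relative_cycle n (N L : set Y) : set (chain n) :=
  [set c | chain_in N c /\
    match n return chain n -> Prop with
    | 0 => fun=> True
    | m.+1 => fun c => chain_in L (boundary c)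
    end c].

Definition relative_boundary n (N L : set Y) : set (chain n) :=
  [set c | exists (d : chain n.+1) (l : chain n),
    [/\ chain_in N d, chain_in L l & c = boundary d + l]].

Definition relative_homology_neq0 n (N L : set Y) : Prop :=
  exists2 c, @relative_cycle n N L c & ~ @relative_boundary n N L c.

End Singular.

Definition conley_index_neq0 (F : fieldType) (R : realType) (Y : topologicalType)
    (Phi : R -> Y -> Y) (S : set Y) : Prop :=
  exists N L : set Y, index_pair Phi S N L /\
    exists k, @relative_homology_neq0 R Y F k N L.

(* Main.v *)
(* If S is empty then so is its suspension, so let (N, L) be an index pair of the
   empty set for the suspension semiflow. Exit times being positive, N is
   forward invariant, hence so is L. The suspension is Hausdorff, so if some
   orbits stayed in N \ L for arbitrarily long times, their limits would form a
   complete orbit in the closure of N \ L, contradicting the emptiness of its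
   invariant part. Hence some time-T map sends N into L, and the prism operator
   of the flow homotopy from the identity to the time-T map shows that every
   relative cycle of (N, L) is a relative boundary. *)
Require Import Defs.
From HB Require Import structures.
From Stdlib Require Import Relation_Operators.
From mathcomp Require Import all_boot all_order all_algebra.
From mathcomp Require Import generic_quotient freeg.
From mathcomp Require Import all_classical all_reals all_analysis.
From mathcomp Require Import zify ring lra.

Set Implicit Arguments.
Unset Strict Implicit.
Unset Printing Implicit Defensive.

Import Order.TTheory GRing.Theory Num.Theory.
Import numFieldNormedType.Exports.

Local Open Scope classical_set_scope.
Local Open Scope ring_scope.
Local Open Scope quotient_scope.

(** * Maps out of glued spaces *)

Section GlueTheory.
Variables (T : topologicalType) (e : T -> T -> Prop).

Lemma glue_pi_eq (x y : T) : e x y -> glue_pi e x = glue_pi e y.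
Proof. by move=> exy; apply/eqmodP/asboolP; exact: rst_step. Qed.

Lemma glue_pi_surj (q : Defs.glue e) : exists x, q = glue_pi e x.
Proof. by exists (glue_repr q); rewrite /glue_pi /glue_repr reprK. Qed.

(** Universal property of the gluing: compatibility with the generators [e] propagates to the
    generated equivalence, so composing [f] with a choice of representatives is continuous and does
    not depend on the choice. *)
Lemma glue_lift (Z : topologicalType) (f : T -> Z) :
  continuous f -> (forall x y, e x y -> f x = f y) ->
  exists2 g : Defs.glue e -> Z, continuous g & forall x, g (glue_pi e x) = f x.
Proof.
move=> cf fe.
have ff x y : clos_refl_sym_trans T e x y -> f x = f y.
  by elim=> [? ? /fe //|//|? ? _ -> //|? ? ? _ -> _ ->].
exists (f \o @glue_repr T e) => [|x /=].
  apply: (@repr_comp_continuous _ {eq_quot glue_equiv e}) => // x y /eqP xy.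
  by apply/eqP/ff; move/eqmodP: xy => /asboolP.
by apply/ff; have /eqmodP/asboolP := reprK (glue_pi e x : {eq_quot glue_equiv e}).
Qed.

End GlueTheory.

(** * Hausdorff property of the hybrid suspension *)

Lemma separating_hausdorff (R : realType) (Y : topologicalType) :
  (forall a b : Y, a <> b -> exists2 f : Y -> R, continuous f & f a <> f b) ->
  hausdorff_space Y.
Proof.
move=> sep a b ab; apply: contrapT => /sep[f cf]; apply.
apply: (@Rhausdorff R) => A B /cf fA /cf fB.
by have [z [Az Bz]] := ab _ _ fA fB; exists (f z).
Qed.

Section SuspensionHausdorff.
Variables (R : realType) (X : metricType R) (H : hybrid_system X).

Lemma mdist_continuous (x : X) : continuous (mdist x : X -> R).
Proof.
move=> y; apply/cvgrPdist_lt => eps eps0.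
apply: filterS (nbhsx_ballx y _ eps0) => z; rewrite ballEmdist /=.
have := metric_triangle x y z; have := metric_triangle x z y.
rewrite (metric_sym z y) ltr_distl; lra.
Qed.

(** The two hypotheses on [h] are compatibility with the bottom and the top identification, so
    [glue_lift] applies twice. *)
Lemma suspension_lift (f : X -> R) (h : cylinder H -> R) :
  continuous f -> continuous h ->
  (forall g s, set_val s = 0 :> R -> h (g, s) = f (set_val g)) ->
  (forall g s, set_val s = 1 :> R -> h (g, s) = f (reset g)) ->
  exists k : suspension H -> R, [/\ continuous k,
    forall x, k (susp_pi (tbase H x)) = f x &
    forall g s, k (susp_pi (tcyl g s)) = h (g, s)].
Proof.
move=> cf ch h0 h1.
pose fam b : presusp_part H b -> R :=
  if b return presusp_part H b -> R then f else h.
have cfam b : continuous (fam b) by case: b.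
have [|k0 ck0 k0E] := @glue_lift _ (@bottom_rel _ _ H) _ _ (sigT_continuous fam cfam).
  by move=> a b [g [s [s0 -> ->]]]; rewrite /=; exact/esym/h0.
have [|k ck kE] := @glue_lift _ (@top_rel _ _ H) _ _ ck0.
  by move=> a b [g [s [s1 -> ->]]]; rewrite !k0E; exact: h1.
exists k; split=> // [x|g s]; by rewrite kE k0E.
Qed.

(** This shape covers both kinds of functions used below: a profile in the height times a function
    on the guard, and a linear interpolation between the two ends of the cylinder. *)
Lemma cylinder_function_continuous (f f' : guard H -> R) (th th' : R -> R) :
  continuous f -> continuous f' -> continuous th -> continuous th' ->
  continuous (fun p : cylinder H =>
    th (set_val p.2) * f p.1 + th' (set_val p.2) * f' p.1).
Proof.
move=> cf cf' cth cth'.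
have cfst (u : guard H -> R) : continuous u ->
    continuous (fun p : cylinder H => u p.1).
  by move=> cu p; apply: (continuous_comp (@cvg_fst _ _ _ _ _)); exact: cu.
have csnd (u : R -> R) : continuous u ->
    continuous (fun p : cylinder H => u (set_val p.2)).
  move=> cu p; apply: (continuous_comp (f := fun p : cylinder H => set_val p.2)).
    apply: (continuous_comp (@cvg_snd _ _ _ _ _)); exact: initial_continuous.
  exact: cu.
by move=> p; apply: cvgD; apply: cvgM; [exact: csnd|exact: cfst|exact: csnd|exact: cfst].
Qed.

(** Both ends of the cylinder are glued to points of X, so only heights strictly between 0 and 1
    remain. *)
Lemma suspension_cases (q : suspension H) :
  (exists x, q = susp_pi (tbase H x)) \/
  (exists g s, 0 < (set_val s : R) < 1 /\ q = susp_pi (tcyl g s)).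
Proof.
have [z ->] := glue_pi_surj q; have [[b a] ->] := glue_pi_surj z.
case: b a => [x|[g s]]; first by left; exists x.
have /andP[s0 s1] : 0 <= (set_val s : R) <= 1 by exact: (set_valP s).
have [s0'|s0'] := eqVneq (set_val s : R) 0.
  left; exists (set_val g); congr (glue_pi _ _).
  by apply/esym/glue_pi_eq; exists g, s.
have [s1'|s1'] := eqVneq (set_val s : R) 1.
  left; exists (reset g).
  by apply/glue_pi_eq; exists g, s.
by right; exists g, s; split => //; rewrite !lt_def s0' s0 eq_sym s1' s1.
Qed.

Lemma suspension_separating (a b : suspension H) :
  a <> b -> exists2 f : suspension H -> R, continuous f & f a <> f b.
Proof.
(* A function on the cylinder that vanishes at both ends extends by 0 to X. *)
have bump (th : R -> R) (f : guard H -> R) : continuous th -> continuous f ->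
    th 0 = 0 -> th 1 = 0 -> exists k : suspension H -> R, [/\ continuous k,
    forall x, k (susp_pi (tbase H x)) = 0 &
    forall g s, k (susp_pi (tcyl g s)) = th (set_val s) * f g].
  move=> cth cf th0 th1.
  (* The zero summand gives the two-term shape of [cylinder_function_continuous]. *)
  have [||g s s0|g s s1|k kP] := @suspension_lift (fun=> 0)
    (fun p => th (set_val p.2) * f p.1 + 0 * 0); last first.
  - exists k; case: kP => ck kb kc; split=> // g s; by rewrite kc /= mul0r addr0.
  - by rewrite /= s1 th1 !mul0r addr0.
  - by rewrite /= s0 th0 !mul0r addr0.
  - apply: (@cylinder_function_continuous _ (fun=> 0) _ (fun=> 0)) => //;
      exact: cst_continuous.
  - exact: cst_continuous.
have cpoly : continuous (fun s : R => s * (1 - s)).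
  move=> s; apply: cvgM; first exact: cvg_id.
  by apply: cvgB; [exact: cvg_cst|exact: cvg_id].
have inner x g s : 0 < (set_val s : R) < 1 ->
    exists2 f : suspension H -> R, continuous f &
      f (susp_pi (tcyl g s)) <> f (susp_pi (tbase H x)).
  move=> /andP[s0 s1]; have [|||k [ck kb kc]] := bump _ (fun=> 1) cpoly.
  - exact: cst_continuous.
  - by rewrite mul0r.
  - by rewrite subrr mulr0.
  exists k => //; rewrite kb kc mulr1; apply/eqP.
  by rewrite gt_eqF // mulr_gt0 // subr_gt0.
have [[x ->]|[g [s [s01 ->]]]] := suspension_cases a;
  have [[y ->]|[g' [s' [s01' ->]]]] := suspension_cases b => ab.
(* Two base points: the distance to [x], interpolated along the cylinder from its value at [g] to
   its value at [reset g], respects both gluings. *)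
- have xy : x != y by apply: contra_not_neq ab => ->.
  have [||g s s0|g s s1|k [ck kb _]] := @suspension_lift (mdist x)
    (fun p => (1 - set_val p.2) * mdist x (set_val p.1)
              + set_val p.2 * mdist x (reset p.1)).
  - exact: mdist_continuous.
  - apply: (@cylinder_function_continuous (fun g => mdist x (set_val g))
      (fun g => mdist x (reset g)) (fun s => 1 - s) id).
    + move=> g; apply: continuous_comp; first exact: initial_continuous.
      exact: mdist_continuous.
    + move=> g; apply: continuous_comp; first exact: reset_continuous.
      exact: mdist_continuous.
    + by move=> s; apply: cvgB; [exact: cvg_cst|exact: cvg_id].
    + by move=> s; exact: cvg_id.
  - by rewrite /= s0 subr0 mul1r mul0r addr0.
  - by rewrite /= s1 subrr mul0r mul1r add0r.
  exists k => //; rewrite !kb mdistxx; apply/eqP.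
  by rewrite lt_eqF // mdist_gt0.
- by have [f cf fne] := inner x g' s' s01'; exists f => // /esym.
- exact: inner.
(* Two interior points: at equal heights the guard points differ and their distance separates;
   otherwise the factor [t - set_val s] in the profile does. *)
have [ss'|ss'] := eqVneq (set_val s : R) (set_val s').
  have gg' : set_val g != set_val g' :> X.
    apply: contra_not_neq ab => gg'; congr (susp_pi (tcyl _ _)); exact: val_inj.
  have [|||k [ck kb kc]] := bump _ (fun h => mdist (set_val g) (set_val h)) cpoly.
  - move=> h; apply: continuous_comp; first exact: initial_continuous.
    exact: mdist_continuous.
  - by rewrite mul0r.
  - by rewrite subrr mulr0.
  exists k => //; rewrite !kc mdistxx mulr0; apply/eqP; case/andP: s01' => ? ?.
  by rewrite lt_eqF // !mulr_gt0 ?subr_gt0 ?mdist_gt0.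
have [||||k [ck kb kc]] := bump (fun t => t * (1 - t) * (t - set_val s)) (fun=> 1).
- move=> t; apply: cvgM; first exact: cpoly.
  by apply: cvgB; [exact: cvg_id|exact: cvg_cst].
- exact: cst_continuous.
- by rewrite !mul0r.
- by rewrite subrr mulr0 mul0r.
exists k => //; rewrite !kc subrr mulr0 !mulr1; apply/eqP.
case/andP: s01' => s0 s1.
rewrite eq_sym !mulf_neq0 ?subr_eq0 ?(gt_eqF s0) ?(gt_eqF s1) //.
by rewrite eq_sym.
Qed.

Lemma suspension_hausdorff : hausdorff_space (suspension H).
Proof. exact: separating_hausdorff suspension_separating. Qed.

End SuspensionHausdorff.

(** * Index pairs of a semiflow on a Hausdorff space *)

Section SemiflowIndexPair.
Variables (R : realType) (Y : topologicalType) (Phi : R -> Y -> Y).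
Hypothesis sf : semiflow Phi.

(** Joint continuity holds only within nonnegative times, hence the requirement that [f] be
    eventually nonnegative. The filter is arbitrary so that one-sided limits, ultrafilters and
    neighbourhoods are all covered. *)
Lemma semiflow_cvg (T : Type) (F : set_system T) (f : T -> R) (g : T -> Y)
    (t : R) (y : Y) : Filter F -> 0 <= t -> (\forall z \near F, 0 <= f z) ->
  f @ F --> t -> g @ F --> y -> Phi (f z) (g z) @[z --> F] --> Phi t y.
Proof.
move=> FF t0 f0 ft gy; case: sf => /subspace_continuousP + _ _.
move=> /(_ (t, y) t0) cPhi A /cPhi wA.
have fg : (f z, g z) @[z --> F] --> (t, y) by exact: cvg_pair ft gy.
have fA : \forall z \near F, 0 <= f z -> A (Phi (f z) (g z)) by exact: (fg _ wA).
by apply: filterS2 fA f0 => z; exact: id.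
Qed.

(* The positive time demanded of points leaving [N] lets one continue past the
   last time spent in [N]. *)
Lemma index_pair_forward_invariant (S N L : set Y) (y : Y) :
  hausdorff_space Y -> index_pair Phi S N L -> N y -> inv_pos Phi N y.
Proof.
move=> hY [[cN _ _] _ _ exitN] Ny; apply: contrapT => NNy.
have clN : closed N by exact: compact_closed.
case: (sf) => _ Phi0 PhiD.
pose E := [set T | 0 <= T /\ stays_until Phi T y N].
have [b [b0 Nb]] : exists b, 0 <= b /\ ~ N (Phi b y).
  apply: contrapT => h; apply: NNy => t t0; apply: contrapT => Nt.
  by apply: h; exists t.
have E0 : E 0.
  split=> // t /andP[t0 t1]; have -> : t = 0 by lra.
  by rewrite Phi0.
have Eb T : E T -> T <= b.
  move=> [T0 sT]; rewrite leNgt; apply/negP => bT; apply: Nb; apply: sT.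
  by rewrite b0 ltW.
have hE : has_sup E by split; [exists 0|exists b].
pose s := sup E.
have s0 : 0 <= s by case: hE => _ hb; exact: ub_le_sup hb _ E0.
have lts t : 0 <= t -> t < s -> N (Phi t y).
  move=> t0 ts; have st : 0 < s - t by rewrite subr_gt0.
  have [T [T0 sT] tT] := sup_adherent st hE.
  by apply: sT; rewrite t0 ltW //; move: tT; rewrite /s opprB addrC subrK.
(* [N] is closed, so the limit from the left stays in it; at [s = 0] that limit would run through
   negative times. *)
have Ns : N (Phi s y).
  have [->|sn0] := eqVneq s 0; first by rewrite Phi0.
  have sp : 0 < s by rewrite lt_def sn0 s0.
  have nN : \forall t \near s^'-, N (Phi t y).
    near=> t; apply: lts => //; near: t; exact: nbhs_left_ge.
  have cv : Phi t y @[t --> s^'-] --> Phi s y.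
    apply: (@semiflow_cvg _ _ id (fun=> y)) => //.
    - near=> t; near: t; exact: nbhs_left_ge.
    - exact: cvg_within.
    - exact: cvg_cst.
  exact: (closed_cvg _ clN nN _ cv).
(* The orbit of [Phi s y] must leave [N] too; its positive time [T] in [N] puts [s + T] into [E],
   past the supremum. *)
have [|T [T0 sT _]] := exitN _ Ns.
  move=> sN; apply: NNy => t t0; have [ts|st] := ltP t s; first exact: lts.
  rewrite -(subrK s t) PhiD ?subr_ge0//; apply: sN; rewrite subr_ge0//.
have : E (s + T).
  split=> [|t /andP[t0 tsT]]; first by rewrite addr_ge0 // ltW.
  have [ts|st] := ltP t s; first exact: lts.
  rewrite -(subrK s t) PhiD ?subr_ge0//; apply: sT.
  by rewrite subr_ge0 st lerBlDr addrC.
have [_ hub] := hE; move=> /(ub_le_sup hub); rewrite -/s; lra.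
Unshelve. all: by end_near. Qed.

(* Limits along an ultrafilter of long orbit segments in a compact set form a
   complete orbit. *)
Lemma compact_complete_orbit (A : set Y) (x : nat -> Y) :
  hausdorff_space Y -> compact A ->
  (forall n t, 0 <= t <= n%:R *+ 2 -> A (Phi t (x n))) ->
  invariant_part Phi A !=set0.
Proof.
move=> hY cA xA.
have clA : closed A by exact: compact_closed.
case: (sf) => _ _ PhiD.
(* A single ultrafilter serves all times at once, which makes the limits for different [t]
   compatible. *)
have [F [UF oF]] := @ultraFilterLemma nat \oo _.
have PF : ProperFilter F by exact: ultra_proper.
have near_ge0 (t : R) : \forall n \near F, 0 <= n%:R + t.
  apply: oF; near=> n; rewrite -lerBlDr sub0r; near: n; exact: nbhs_infty_ger.
have near_le (t : R) : \forall n \near F, n%:R + t <= n%:R *+ 2.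
  apply: oF; near=> n; rewrite mulr2n lerD2l; near: n; exact: nbhs_infty_ger.
(* Time is recentred at the midpoint n of [0, 2n], so each fixed [t], negative ones included,
   eventually falls inside the segment. *)
have nA t : \forall n \near F, A (Phi (n%:R + t) (x n)).
  near=> n; apply: xA; apply/andP; split; near: n; [exact: near_ge0|exact: near_le].
have lim t : exists p : Y, Phi (n%:R + t) (x n) @[n --> F] --> p.
  pose G : set_system Y := fmap (fun n : nat => Phi (n%:R + t) (x n)) F.
  have UG : UltraFilter G.
    split=> [|G' PG' GG']; first exact: fmap_proper_filter.
    rewrite predeqE => B; split; last exact: GG'.
    move=> G'B; have [//|NB] := in_ultra_setVsetC
      ((fun n : nat => Phi (n%:R + t) (x n)) @^-1` B) UF.
    have : G' (~` B) by exact: GG'.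
    by move=> /(filterI G'B); rewrite setICr => /filter_not_empty.
  move: cA; rewrite compact_ultra => /(_ G UG (nA t)) [p [_ Gp]].
  by exists p.
have [gam gamP] := choice lim.
have Agam t : A (gam t).
  exact: (closed_cvg _ clA (nA t) _ (gamP t)).
(* Both sides are limits of the same family along [F]: continuity of [Phi s] on the left, the
   semigroup law on the right. *)
have gamD s t : 0 <= s -> Phi s (gam t) = gam (t + s).
  move=> s0; apply: (@cvg_unique _ hY (Phi (n%:R + (t + s)) (x n) @[n --> F])).
    have sc : Phi s (Phi (n%:R + t) (x n)) @[n --> F] --> Phi s (gam t).
      apply: (semiflow_cvg (f := fun=> s) _ s0 _ _ (gamP t)).
      - exact: nearW.
      - exact: cvg_cst.
    apply: cvg_trans sc; apply: near_eq_cvg; near=> n.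
    rewrite -PhiD //; first by congr Phi; ring.
    by near: n; exact: near_ge0.
  exact: gamP.
exists (gam 0); split.
  by move=> t t0; rewrite gamD.
by exists gam; split => // s t s0 _; exact: gamD.
Unshelve. all: by end_near. Qed.

Lemma index_pair_empty_absorbed (N L : set Y) :
  hausdorff_space Y -> index_pair Phi set0 N L ->
  exists2 T, 0 <= T & forall y, N y -> L (Phi T y).
Proof.
move=> hY ip; have fwd := index_pair_forward_invariant hY ip.
case: (ip) => -[cN cL LN] [inv0 _] Linv _.
case: (sf) => _ _ PhiD.
apply: contrapT => noT.
have [|x xP] := @choice _ _ (fun (n : nat) (y : Y) => N y /\ ~ L (Phi (n%:R *+ 2) y)).
  move=> n; apply: contrapT => nx; apply: noT.
  exists (n%:R *+ 2); first by rewrite mulrn_wge0.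
  by move=> y Ny; apply: contrapT => NL; apply: nx; exists y.
(* The point [x n] starts in [N] and is outside [L] at time 2n. *)
have clN : closed N by exact: compact_closed.
have cA : compact (closure (N `\` L)).
  apply: (subclosed_compact _ cN); first exact: closed_closure.
  by apply: subset_trans clN; apply: closure_subset => y [].
have [n t /andP[t0 tn]|p] := compact_complete_orbit hY cA (x := x).
  have [Nx Lx] := xP n; apply: subset_closure; split; first exact: fwd.
  (* An orbit that meets [L] at time [t] cannot leave it without leaving [N], so it would still be
     in [L] at time 2n. *)
  move=> Lt; apply: Lx; rewrite -(subrK t (n%:R *+ 2)) PhiD ?subr_ge0//.
  apply: (Linv _ (n%:R *+ 2 - t) Lt); rewrite ?subr_ge0 // ?lexx ?andbT ?subr_ge0 //.
  by move=> s /andP[s0 _]; apply: fwd => //; exact: LN.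
by rewrite -inv0.
Qed.

Lemma index_pair_exit_invariant (S N L : set Y) (y : Y) :
  hausdorff_space Y -> index_pair Phi S N L -> L y -> inv_pos Phi L y.
Proof.
move=> hY ip Ly t t0; have fwd := index_pair_forward_invariant hY ip.
case: ip => -[_ _ LN] _ Linv _.
apply: (Linv y t Ly t0) => [s /andP[s0 _]|]; last by rewrite t0 lexx.
by apply: fwd => //; exact: LN.
Qed.

End SemiflowIndexPair.

(** * Signed sums in the prism identity *)

(* [a i j], [b j i] and [d k] stand for the j-th face of the i-th prism simplex,
   the i-th prism simplex of the j-th face, and the wall shared by the (k-1)-st
   and k-th prism simplices. *)
Lemma alternating_prism_sum (F : pzRingType) (V : lmodType F) (N : nat)
    (a b : nat -> nat -> V) (d : nat -> V) :
  (forall i, (i <= N)%N -> a i i = d i) ->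
  (forall i, (i <= N)%N -> a i i.+1 = d i.+1) ->
  (forall i j, (j <= i < N)%N -> a i.+1 j = b j i) ->
  (forall i j, (i < j <= N)%N -> a i j.+1 = b j i) ->
  \sum_(0 <= i < N.+1) \sum_(0 <= j < N.+2) (-1) ^+ (i + j) *: a i j +
    \sum_(0 <= j < N.+1) \sum_(0 <= i < N) (-1) ^+ (j + i) *: b j i =
  d 0%N - d N.+1.
Proof.
move=> aii aiS alt agt.
pose u i j := (-1) ^+ (i + j) *: b j i.
have uS i j : (-1) ^+ (i + j).+1 *: b j i = - u i j.
  by rewrite exprS mulN1r scaleNr.
(* Each row splits into the faces below the diagonal, the two walls, and the faces above, where
   shifting [j] by one flips the sign. The walls then telescope over [i]. *)
have rowE i : (i <= N)%N -> \sum_(0 <= j < N.+2) (-1) ^+ (i + j) *: a i j =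
    \sum_(0 <= j < i) (-1) ^+ (i + j) *: a i j + (d i - d i.+1)
    - \sum_(i.+1 <= j < N.+1) u i j.
  move=> iN; rewrite (big_cat_nat (n := i)) //=; last by lia.
  rewrite (@big_ltn _ _ _ i N.+2) ?(@big_ltn _ _ _ i.+1 N.+2); [|lia..].
  rewrite big_add1 /= aii // aiS // addnn -signr_odd odd_double expr0 scale1r.
  rewrite addnS addnn exprS -signr_odd odd_double expr0 mulr1 scaleN1r.
  rewrite -!addrA; congr (_ + (_ + (_ + _))).
  rewrite -sumrN; apply: eq_big_nat => j ij.
  by rewrite agt ?addnS ?uS.
rewrite (eq_big_nat _ _ (F2 := fun i =>
    \sum_(0 <= j < i) (-1) ^+ (i + j) *: a i j + (d i - d i.+1)
    - \sum_(i.+1 <= j < N.+1) u i j)); last by move=> i iN; apply: rowE; lia.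
rewrite !big_split /= -(opprB (d N.+1)) -(telescope_sumr d (leq0n N.+1)) -!sumrN.
rewrite big_nat_recl // big_geq // add0r.
have -> : \sum_(0 <= i < N) \sum_(0 <= j < i.+1) (-1) ^+ (i.+1 + j) *: a i.+1 j =
    - \sum_(0 <= i < N) \sum_(0 <= j < i.+1) u i j.
  rewrite -sumrN; apply: eq_big_nat => i iN.
  by rewrite -sumrN; apply: eq_big_nat => j ij; rewrite alt ?addSn ?uS //; lia.
(* Exchanged and cut at the diagonal, the second double sum cancels both off-diagonal parts of the
   first. *)
have -> : \sum_(0 <= j < N.+1) \sum_(0 <= i < N) (-1) ^+ (j + i) *: b j i =
    \sum_(0 <= i < N) \sum_(0 <= j < i.+1) u i j +
    \sum_(0 <= i < N) \sum_(i.+1 <= j < N.+1) u i j.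
  rewrite exchange_big_nat -big_split /=; apply: eq_big_nat => i iN.
  rewrite -big_cat_nat //=; last by lia.
  by apply: eq_bigr => j _; rewrite /u addnC.
have -> : \sum_(0 <= i < N.+1) - \sum_(i.+1 <= j < N.+1) u i j =
    - \sum_(0 <= i < N) \sum_(i.+1 <= j < N.+1) u i j.
  by rewrite big_nat_recr //= [in X in _ + X]big_geq // oppr0 addr0 sumrN.
rewrite -big_split /= [in RHS](eq_bigr _ (fun i _ => opprB (d i.+1) (d i))).
set A := \sum_(0 <= i < N) _; set B := \sum_(0 <= i < N) _.
set D := \sum_(0 <= i < N.+1) _.
by rewrite addrACA addNr addr0 addrAC addNr add0r.
Qed.

(** * Affine maps of simplices given on vertices *)

Section AffineSimplexMaps.
Variable R : realType.

(** The affine extension of the vertex map [th] in barycentric coordinates. *)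
Definition simplex_push_point m n (th : 'I_m -> 'I_n) (v : 'rV[R]_m) : 'rV[R]_n :=
  \row_k \sum_(j | th j == k) v ord0 j.

Lemma simplex_push_point_simplex m n (th : 'I_m.+1 -> 'I_n.+1)
    (v : @std_simplex R m) :
  simplex_push_point th (set_val v) \in @std_simplex R n.
Proof.
have [v_ge0 v_sum] : @std_simplex R m (set_val v) by exact: set_valP.
rewrite inE; split=> [k|].
  by rewrite mxE; apply: sumr_ge0 => j _; exact: v_ge0.
rewrite -v_sum [RHS](partition_big th predT) //=.
by apply: eq_bigr => k _; rewrite mxE.
Qed.

Definition simplex_push m n (th : 'I_m.+1 -> 'I_n.+1) (v : @std_simplex R m) :
    @std_simplex R n :=
  exist _ (simplex_push_point th (set_val v)) (simplex_push_point_simplex th v).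

(** The affine function with value 1 on the vertices in [p] and 0 on the others; it serves as the
    time coordinate of the prism. *)
Definition simplex_weight m (p : pred 'I_m.+1) (v : @std_simplex R m) : R :=
  \sum_(j | p j) set_val v ord0 j.

Lemma simplex_weight_ge0 m p (v : @std_simplex R m) : 0 <= simplex_weight p v.
Proof.
have [v_ge0 _] : @std_simplex R m (set_val v) by exact: set_valP.
by apply: sumr_ge0 => j _; exact: v_ge0.
Qed.

Lemma simplex_weight1 m (v : @std_simplex R m) : simplex_weight predT v = 1.
Proof. by have [_] : @std_simplex R m (set_val v) by exact: set_valP. Qed.

Lemma simplex_weight_continuous m (p : pred 'I_m.+1) :
  continuous (@simplex_weight m p).
Proof.
apply: continuous_big => [|j _]; first exact: add_continuous.
move=> v; apply: (@continuous_comp _ _ _ (set_val : @std_simplex R m -> _)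
  (fun w : 'rV[R]_m.+1 => w ord0 j)).
- exact: initial_continuous.
- exact: coord_continuous.
Qed.

(** Coordinates are regrouped by the fibres of [th]. Taking for [p] a fibre of a second vertex map
    gives functoriality of [simplex_push]. *)
Lemma simplex_weight_push m n (th : 'I_m.+1 -> 'I_n.+1) (p : pred 'I_n.+1) v :
  simplex_weight p (simplex_push th v) = simplex_weight (p \o th) v.
Proof.
rewrite /simplex_weight [RHS](partition_big th p) //=; apply: eq_bigr => k pk.
rewrite set_valE /= mxE; apply: eq_bigl => j.
by case: eqP => [->|]; rewrite ?pk ?andbF.
Qed.

Lemma simplex_push_continuous m n (th : 'I_m.+1 -> 'I_n.+1) :
  continuous (simplex_push th).
Proof.
apply: continuous_comp_initial => v A [P vP PA].
apply: (@filterS _ _ (nbhs_filter v) (fun w : @std_simplex R m => forall k,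
  P ord0 k (simplex_push_point th (set_val w) ord0 k))).
  by move=> w Pw; apply: PA => a j; rewrite ord1; exact: Pw.
apply: (@filter_forall _ _ (fun k (w : @std_simplex R m) =>
  P ord0 k (simplex_push_point th (set_val w) ord0 k)) _ (nbhs_filter v)) => k.
have := vP ord0 k; rewrite /= mxE => Pk.
have := @simplex_weight_continuous m (fun j => th j == k) v _ Pk.
apply: (@filterS _ _ (nbhs_filter v)) => w; rewrite /simplex_push_point mxE; exact: id.
Qed.

Lemma simplex_push_comp l m n (th : 'I_l.+1 -> 'I_m.+1) (ph : 'I_m.+1 -> 'I_n.+1) v :
  simplex_push ph (simplex_push th v) = simplex_push (ph \o th) v.
Proof.
apply: val_inj; apply/rowP => k; rewrite !mxE.
exact: (@simplex_weight_push _ _ th (fun j => ph j == k)).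
Qed.

Lemma simplex_push_id m (v : @std_simplex R m) : simplex_push id v = v.
Proof.
by apply: val_inj; apply/rowP => k; rewrite mxE big_pred1_eq.
Qed.

Lemma face_map_push n (i : 'I_n.+2) (v : @std_simplex R n) :
  face_map i v = simplex_push (fintype.lift i) v.
Proof.
apply: val_inj; apply/rowP => j; rewrite !mxE; case: unliftP => [k ->|->] /=.
  by rewrite (eq_bigl (pred1 k)) ?big_pred1_eq // => l; rewrite (inj_eq lift_inj).
by rewrite big_pred0 // => l; rewrite eq_sym (negbTE (neq_lift _ _)).
Qed.

End AffineSimplexMaps.

(** * Linear extension and supports of singular chains *)

Section Chains.
Variables (R : realType) (Y : topologicalType) (F : fieldType).

Lemma fglift_is_linear (K : choiceType) (V : lmodType F) (f : K -> V) :
  linear (fglift f : {freeg K / F} -> V).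
Proof.
(* Additivity is available for differences; sums are recovered through 0 and opposites. *)
have fglift0 : fglift f 0 = 0.
  by have := @lift_is_additive F K V f 0 0; rewrite !subrr.
have fgliftN y : fglift f (- y) = - fglift f y.
  by have := @lift_is_additive F K V f 0 y; rewrite fglift0 !sub0r.
have fgliftD : {morph fglift f : x y / x + y}.
  by move=> x y; rewrite -[y in LHS]opprK lift_is_additive fgliftN opprK.
have fglift_sum (I : Type) (r : seq I) (G : I -> {freeg K / F}) :
    fglift f (\sum_(i <- r) G i) = \sum_(i <- r) fglift f (G i).
  by elim/big_rec2: _ => // i x y _ <-; rewrite fgliftD.
move=> k x y; rewrite fgliftD; congr (_ + _).
rewrite -[x in RHS]freeg_sumE !fglift_sum scaler_sumr.
by apply: eq_bigr => z _; rewrite !liftU scalerA.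
Qed.

HB.instance Definition _ (K : choiceType) (V : lmodType F) (f : K -> V) :=
  GRing.isLinear.Build F {freeg K / F} V *:%R (fglift f) (fglift_is_linear f).

Lemma fgliftE (K : choiceType) (V : lmodType F) (f : K -> V) (c : {freeg K / F}) :
  fglift f c = \sum_(s <- dom c) coeff s c *: f s.
Proof.
rewrite -[c in LHS]freeg_sumE raddf_sum; apply: eq_bigr => s _; exact: liftU.
Qed.

Definition simplex_chain n (s : singular_simplex R Y n) : chain R Y F n := << s >>.

Lemma fglift_simplex_chain n (V : lmodType F) (f : singular_simplex R Y n -> V) s :
  fglift f (simplex_chain s) = f s.
Proof. by rewrite liftU scale1r. Qed.

Lemma freegZU (K : choiceType) (k l : F) (s : K) : k *: << l *g s >> = << k * l *g s >>.
Proof. by apply/eqP/freeg_eqP => x; rewrite coeffZ !coeffU mulrA. Qed.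

Lemma chain_inP n (A : set Y) (c : chain R Y F n) :
  chain_in A c <-> forall s, coeff s c != 0 -> forall v, A (simplex_map s v).
Proof. by split=> h s; move: (h s); rewrite mem_dom. Qed.

Lemma chain_in0 n (A : set Y) : chain_in A (0 : chain R Y F n).
Proof. by apply/chain_inP => s; rewrite coeff0 eqxx. Qed.

Lemma chain_inD n (A : set Y) (c d : chain R Y F n) :
  chain_in A c -> chain_in A d -> chain_in A (c + d).
Proof.
move=> /chain_inP Ac /chain_inP Ad; apply/chain_inP => s; rewrite coeffD.
have [/Ac //|] := boolP (coeff s c != 0).
by rewrite negbK => /eqP ->; rewrite add0r; exact: Ad.
Qed.

Lemma chain_inZ n (A : set Y) (k : F) (c : chain R Y F n) :
  chain_in A c -> chain_in A (k *: c).
Proof.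
move=> /chain_inP Ac; apply/chain_inP => s; rewrite coeffZ mulf_eq0 negb_or.
by case/andP => _; exact: Ac.
Qed.

Lemma chain_in_sum n (A : set Y) (I : eqType) (r : seq I) (f : I -> chain R Y F n) :
  (forall i, i \in r -> chain_in A (f i)) -> chain_in A (\sum_(i <- r) f i).
Proof.
move=> Af; rewrite big_seq; elim/big_rec: _ => [|i c ir Ac]; first exact: chain_in0.
by apply: chain_inD => //; exact: Af.
Qed.

Lemma chain_inU n (A : set Y) (s : singular_simplex R Y n) :
  (forall v, A (simplex_map s v)) -> chain_in A (simplex_chain s).
Proof. by move=> As t; rewrite domU1 inE => /eqP ->. Qed.

Lemma chain_in_fglift m n (A B : set Y)
    (f : singular_simplex R Y m -> chain R Y F n) (c : chain R Y F m) :
  (forall s, (forall v, A (simplex_map s v)) -> chain_in B (f s)) ->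
  chain_in A c -> chain_in B (fglift f c).
Proof.
move=> fB Ac; rewrite fgliftE; apply: chain_in_sum => s sc.
by apply: chain_inZ; apply: fB; exact: Ac.
Qed.

End Chains.

(** * The prism operator of the flow homotopy *)

Section Prism.
Variables (R : realType) (Y : topologicalType) (F : fieldType) (Phi : R -> Y -> Y).
Hypothesis sf : semiflow Phi.
Variable T : R.
Hypothesis T0 : 0 <= T.

Lemma singular_simplex_eq n (c d : singular_simplex R Y n) :
  simplex_map c =1 simplex_map d -> c = d.
Proof.
case: c d => [f fc] [g gc] /= /funext fg; move: gc; rewrite -fg => gc.
by congr SingularSimplex; exact: Prop_irrelevance.
Qed.

(* In the prism [0, T] x Delta_n this is the simplex with vertices (T, th j)
   for [p j] and (0, th j) otherwise, mapped to [Y] by the flow. *)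
Definition flow_simplex_map m n (c : singular_simplex R Y n)
    (th : 'I_m.+1 -> 'I_n.+1) (p : pred 'I_m.+1) (v : @std_simplex R m) : Y :=
  Phi (T * simplex_weight p v) (simplex_map c (simplex_push th v)).

Lemma flow_simplex_continuous m n c th p : continuous (@flow_simplex_map m n c th p).
Proof.
move=> v; apply: (@semiflow_cvg _ _ _ sf _ (nbhs v)
  (fun w => T * simplex_weight p w) (fun w => simplex_map c (simplex_push th w))).
- by rewrite mulr_ge0 // simplex_weight_ge0.
- by apply: nearW => w; rewrite mulr_ge0 // simplex_weight_ge0.
- apply: cvgMl_tmp; exact: simplex_weight_continuous.
- apply: (continuous_comp (@simplex_push_continuous _ _ _ th v)).
  exact: simplex_continuous.
Qed.

Definition flow_simplex m n c th p : singular_simplex R Y m :=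
  SingularSimplex (@flow_simplex_continuous m n c th p).

Lemma flow_simplex_in m n c th p (A : set Y) :
  (forall y, A y -> inv_pos Phi A y) -> (forall v, A (simplex_map c v)) ->
  forall v, A (simplex_map (@flow_simplex m n c th p) v).
Proof.
by move=> fwd Ac v; apply: fwd => //; rewrite mulr_ge0 // simplex_weight_ge0.
Qed.

Lemma eq_flow_simplex m n c th th' p p' :
  th =1 th' -> p =1 p' -> @flow_simplex m n c th p = flow_simplex c th' p'.
Proof. by move=> /funext -> /funext ->. Qed.

Lemma simplex_face_flow m n c th p i :
  simplex_face (@flow_simplex m.+1 n c th p) i =
  flow_simplex c (th \o fintype.lift i) (p \o fintype.lift i).
Proof.
apply: singular_simplex_eq => v; rewrite /= /flow_simplex_map face_map_push.
by rewrite simplex_weight_push simplex_push_comp.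
Qed.

Lemma flow_simplex_face m n c th p i :
  @flow_simplex m n (simplex_face c i) th p =
  flow_simplex c (fintype.lift i \o th) p.
Proof.
apply: singular_simplex_eq => v; rewrite /= /flow_simplex_map /= face_map_push.
by rewrite simplex_push_comp.
Qed.

(** For [i <= n] this repeats the vertex [i], as the image of both [i] and [i.+1]. *)
Definition degeneracy n (i : nat) (j : 'I_n.+2) : 'I_n.+1 := inord (unbump i j).

(** The standard triangulation of the prism: vertices 0 to i at time 0, then i to n at time [T]. *)
Definition prism_simplex n (c : singular_simplex R Y n) (i : nat) :
    singular_simplex R Y n.+1 :=
  flow_simplex c (degeneracy i) (fun j => i < j)%N.

(** The wall with vertices below [k] at time 0 and the others at time [T]: [k = 0] is the image of
    [c] under the time-[T] map, [k = n.+1] is [c] itself. *)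
Definition diagonal_simplex n (c : singular_simplex R Y n) (k : nat) :
    singular_simplex R Y n :=
  flow_simplex c id (fun j => k <= j)%N.

Definition prism n : chain R Y F n -> chain R Y F n.+1 :=
  fglift (fun c => \sum_(i < n.+1) (-1) ^+ i *: simplex_chain F (prism_simplex c i)).

Definition flow_chain n : chain R Y F n -> chain R Y F n :=
  fglift (fun c => simplex_chain F (diagonal_simplex c 0)).

Lemma diagonal_simplex_last n (c : singular_simplex R Y n) :
  diagonal_simplex c n.+1 = c.
Proof.
apply: singular_simplex_eq => v; rewrite /= /flow_simplex_map simplex_push_id.
rewrite /simplex_weight big_pred0 ?mulr0; first by case: sf.
by move=> j; rewrite leqNgt ltn_ord.
Qed.

(** Dropping either copy of the repeated vertex [i] leaves a wall. *)
Lemma face_prism_diag n (c : singular_simplex R Y n) (i : nat) (j : 'I_n.+2) :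
  (i <= n)%N -> (j == i :> nat) || (j == i.+1 :> nat) ->
  simplex_face (prism_simplex c i) j = diagonal_simplex c j.
Proof.
move=> ile ij; rewrite simplex_face_flow; apply: eq_flow_simplex => k /=.
  apply/val_inj; rewrite /= inordK /unbump /= /bump; have := ltn_ord k; lia.
by rewrite /bump; lia.
Qed.

(** The dropped vertex lies at time 0 before the repeated one, whose index falls by one in the
    face. *)
Lemma face_prism_lt n (c : singular_simplex R Y n.+1) (i : nat)
    (j : 'I_n.+3) (j' : 'I_n.+2) :
  (j <= i)%N -> (i <= n)%N -> j = j' :> nat ->
  simplex_face (prism_simplex c i.+1) j = prism_simplex (simplex_face c j') i.
Proof.
move=> ji ile jj'; rewrite /prism_simplex simplex_face_flow flow_simplex_face.
apply: eq_flow_simplex => k /=.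
  apply/val_inj; rewrite /= !inordK /unbump /= /bump; have := ltn_ord k; lia.
by rewrite /bump; lia.
Qed.

(** The dropped vertex is [j'] at time [T], which the repetition of [i] shifts to position
    [j'.+1]. *)
Lemma face_prism_gt n (c : singular_simplex R Y n.+1) (i : nat)
    (j : 'I_n.+3) (j' : 'I_n.+2) :
  (i < j')%N -> j = j'.+1 :> nat ->
  simplex_face (prism_simplex c i) j = prism_simplex (simplex_face c j') i.
Proof.
move=> ij jj'; rewrite /prism_simplex simplex_face_flow flow_simplex_face.
apply: eq_flow_simplex => k /=.
  apply/val_inj; rewrite /= !inordK /unbump /= /bump; have := ltn_ord k;
    have := ltn_ord j'; lia.
by rewrite /bump; lia.
Qed.

Lemma boundary_linear n : linear (@boundary R Y F n).
Proof. exact: linearP. Qed.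

HB.instance Definition _ n :=
  GRing.isLinear.Build F (chain R Y F n.+1) (chain R Y F n) *:%R
  (@boundary R Y F n) (@boundary_linear n).

Lemma prism_linear n : linear (@prism n).
Proof. exact: linearP. Qed.

HB.instance Definition _ n :=
  GRing.isLinear.Build F (chain R Y F n) (chain R Y F n.+1) *:%R
  (@prism n) (@prism_linear n).

Lemma flow_chain_linear n : linear (@flow_chain n).
Proof. exact: linearP. Qed.

HB.instance Definition _ n :=
  GRing.isLinear.Build F (chain R Y F n) (chain R Y F n) *:%R
  (@flow_chain n) (@flow_chain_linear n).

(** Natural-number indices, with [inord] for the faces, fit the form of [alternating_prism_sum]. *)
Lemma boundaryU n (s : singular_simplex R Y n.+1) :
  boundary (simplex_chain F s) =
  \sum_(0 <= j < n.+2) (-1) ^+ j *: simplex_chain F (simplex_face s (inord j)).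
Proof.
rewrite /boundary fglift_simplex_chain big_mkord; apply: eq_bigr => j _.
by rewrite inord_val.
Qed.

Lemma prismU n (s : singular_simplex R Y n) :
  prism (simplex_chain F s) =
  \sum_(0 <= i < n.+1) (-1) ^+ i *: simplex_chain F (prism_simplex s i).
Proof. by rewrite /prism fglift_simplex_chain big_mkord. Qed.

Lemma boundary_prismU n (s : singular_simplex R Y n) :
  boundary (prism (simplex_chain F s)) =
  \sum_(0 <= i < n.+1) \sum_(0 <= j < n.+2)
    (-1) ^+ (i + j) *: simplex_chain F (simplex_face (prism_simplex s i) (inord j)).
Proof.
rewrite prismU linear_sum /=; apply: eq_bigr => i _.
rewrite linearZ_LR /= boundaryU scaler_sumr.
by apply: eq_bigr => j _; rewrite scalerA exprD.
Qed.

Lemma prism_boundaryU n (s : singular_simplex R Y n.+1) :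
  prism (boundary (simplex_chain F s)) =
  \sum_(0 <= j < n.+2) \sum_(0 <= i < n.+1)
    (-1) ^+ (j + i) *: simplex_chain F (prism_simplex (simplex_face s (inord j)) i).
Proof.
rewrite boundaryU linear_sum /=; apply: eq_bigr => i _.
rewrite linearZ_LR /= prismU scaler_sumr.
by apply: eq_bigr => j _; rewrite scalerA exprD.
Qed.

Lemma chain_ind n (P : chain R Y F n -> Prop) :
  P 0 -> (forall k s c, P c -> P (k *: simplex_chain F s + c)) -> forall c, P c.
Proof.
move=> P0 PD c; rewrite -[c]freeg_sumE; elim/big_rec: _ => // s d _ Pd.
have -> : << coeff s c *g s >> = coeff s c *: simplex_chain F s.
  by rewrite freegZU mulr1.
exact: PD.
Qed.

Lemma boundary_prism0 (c : chain R Y F 0) : boundary (prism c) = flow_chain c - c.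
Proof.
elim/chain_ind: c => [|k s c IH].
  by rewrite !linear0 !addr0.
rewrite prism_linear boundary_linear flow_chain_linear IH.
rewrite opprD addrACA -scalerBr; congr (_ *: _ + _).
rewrite boundary_prismU /flow_chain fglift_simplex_chain.
(* In degree 0 there are no faces to take prisms over: [b] is zero and its inner sum is empty. *)
have := @alternating_prism_sum F (chain R Y F 0) 0
  (fun i j => simplex_chain F (simplex_face (prism_simplex s i) (inord j)))
  (fun _ _ => 0) (fun k => simplex_chain F (diagonal_simplex s k)).
rewrite diagonal_simplex_last [X in _ + X = _]big_nat1 [X in _ + X = _]big_geq // addr0.
apply => [i i0|i i0|i j ij|i j ij]; [| |by lia..].
- by rewrite face_prism_diag ?inordK //; lia.
- by rewrite face_prism_diag ?inordK //; lia.
Qed.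

(** Chain homotopy between the identity and the time-[T] map; by linearity it suffices to check
    single simplices, where the extreme walls are the two ends of the homotopy. *)
Lemma boundary_prismS n (c : chain R Y F n.+1) :
  boundary (prism c) + prism (boundary c) = flow_chain c - c.
Proof.
elim/chain_ind: c => [|k s c IH].
  by rewrite !linear0 !addr0.
rewrite prism_linear !boundary_linear prism_linear flow_chain_linear.
rewrite addrACA -scalerDr IH opprD addrACA -scalerBr; congr (_ *: _ + _).
rewrite boundary_prismU prism_boundaryU /flow_chain fglift_simplex_chain.
have := @alternating_prism_sum F (chain R Y F n.+1) n.+1
  (fun i j => simplex_chain F (simplex_face (prism_simplex s i) (inord j)))
  (fun j i => simplex_chain F (prism_simplex (simplex_face s (inord j)) i))
  (fun k => simplex_chain F (diagonal_simplex s k)).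
rewrite diagonal_simplex_last; apply => [i i0|i i0|i j ij|i j ij].
- by rewrite face_prism_diag ?inordK //; lia.
- by rewrite face_prism_diag ?inordK //; lia.
- by rewrite (@face_prism_lt _ s i _ (inord j)) ?inordK //; lia.
- by rewrite (@face_prism_gt _ s i _ (inord j)) ?inordK //; lia.
Qed.

Lemma chain_in_prism n (A : set Y) (c : chain R Y F n) :
  (forall y, A y -> inv_pos Phi A y) -> chain_in A c -> chain_in A (prism c).
Proof.
move=> fwd; apply: chain_in_fglift => s As; apply: chain_in_sum => i _.
by apply: chain_inZ; apply: chain_inU; exact: flow_simplex_in.
Qed.

Lemma chain_in_flow n (A B : set Y) (c : chain R Y F n) :
  (forall y, A y -> B (Phi T y)) -> chain_in A c -> chain_in B (flow_chain c).
Proof.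
move=> AB; apply: chain_in_fglift => s As; apply: chain_inU => v.
by rewrite /= /flow_simplex_map simplex_push_id simplex_weight1 mulr1; exact: AB.
Qed.

(** The homotopy identity is solved for [c]: the flowed chain lies in [L] by absorption, and in
    positive degree the prism over the boundary lies in [L] because [L] is forward invariant. *)
Lemma absorbed_relative_boundary n (N L : set Y) (c : chain R Y F n) :
  (forall y, N y -> inv_pos Phi N y) -> (forall y, L y -> inv_pos Phi L y) ->
  (forall y, N y -> L (Phi T y)) ->
  relative_cycle N L c -> relative_boundary N L c.
Proof.
move=> fN fL NL; case: n c => [|n] c [Nc Lc].
  exists (- prism c), (flow_chain c); split.
  - by rewrite -scaleN1r; apply: chain_inZ; exact: chain_in_prism.
  - exact: chain_in_flow Nc.
  - by rewrite linearN /= boundary_prism0 opprB subrK.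
exists (- prism c), (flow_chain c - prism (boundary c)); split.
- by rewrite -scaleN1r; apply: chain_inZ; exact: chain_in_prism.
- apply: chain_inD; first exact: chain_in_flow Nc.
  by rewrite -scaleN1r; apply: chain_inZ; exact: chain_in_prism.
- have /eqP := boundary_prismS c; rewrite eq_sym subr_eq => /eqP ->.
  by rewrite linearN /= addrAC addrK addKr.
Qed.

End Prism.

(** * Vanishing of the index of the empty set, and the conclusion *)

Lemma index_pair_empty_acyclic (R : realType) (Y : topologicalType) (F : fieldType)
    (Phi : R -> Y -> Y) (N L : set Y) n (c : chain R Y F n) :
  hausdorff_space Y -> semiflow Phi -> index_pair Phi set0 N L ->
  relative_cycle N L c -> relative_boundary N L c.
Proof.
move=> hY sf ip; have [T T0 NL] := index_pair_empty_absorbed sf hY ip.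
apply: (absorbed_relative_boundary sf T0) => // y.
- exact: (index_pair_forward_invariant sf hY ip).
- exact: (index_pair_exit_invariant sf hY ip).
Qed.

Theorem theorem4p18 (F : fieldType) (R : realType) (X : metricType R)
    (H : hybrid_system X) (S : set X)
    (Phi : R -> suspension H -> suspension H) :
  compact [set: X] ->
  nonblocking H ->
  trapping_guard_condition H ->
  hybrid_isolated_invariant H S ->
  suspension_semiflow Phi ->
  conley_index_neq0 F Phi (susp_set H S) ->
  S !=set0.
Proof.
move=> _ _ _ _ [sf _] [N [L [ip [k [c cycle_c nbound_c]]]]].
apply/set0P/eqP => S0; apply: nbound_c.
apply: (index_pair_empty_acyclic _ sf _ cycle_c); first exact: suspension_hausdorff.
by rewrite S0 /susp_set preimage_set0 image_set0 in ip.
Qed.
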